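(* Consider an instance of the UKPB with item types $j=1,\dots,n'$, profits $p_j\in\mathbb{N}^+$, weights $w_j\in\mathbb{N}^+$ with $p_j,w_j\le R$, and capacity $C$, the types being ordered so that $p_1/w_1\ge p_2/w_2\ge\dots\ge p_{n'}/w_{n'}$. Let $N_2=\{j : p_j/w_j<p_1/w_1\}$. Then every optimal solution $\mathbf{Y}=(y_1,\dots,y_{n'})$ satisfies $$\sum_{j\in N_2}y_jw_j\le R^3.$$
   Context: The UKPB: maximize $\sum_{j=1}^{n'}p_jx_j$ subject to $\sum_{j=1}^{n'}w_jx_j\le C$, $x_j\in\mathbb{N}$, where $p_j,w_j\in\mathbb{N}^+$, $p_j,w_j\le R$ for a given positive integer $R$. The quantity $p_j/w_j$ is the profit density of type $j$. *)

(* Defs.v *)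
From HB Require Import structures.
From mathcomp Require Import all_boot all_order all_algebra.

Set Implicit Arguments.
Unset Strict Implicit.
Unset Printing Implicit Defensive.

Import Order.TTheory GRing.Theory Num.Theory.

(* Unbounded knapsack with item types indexed by 'I_n.+1: the types 1, ..., n'
   are 0, ..., n with n' = n.+1, so that type 1 exists and is ord0. *)
Section UnboundedKnapsack.

Variables (n : nat) (p w : 'I_n.+1 -> nat) (C : nat).
Implicit Types (j : 'I_n.+1) (x : 'I_n.+1 -> nat).

Definition profit x : nat := \sum_j p j * x j.

Definition weight x : nat := \sum_j w j * x j.

Definition feasible x : Prop := weight x <= C.

Definition optimal x : Prop :=
  feasible x /\ forall z : 'I_n.+1 -> nat, feasible z -> profit z <= profit x.

Definition density j : rat := ((p j)%:R / (w j)%:R)%R.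

Definition sorted_by_density : Prop :=
  forall i j : 'I_n.+1, i <= j -> (density j <= density i)%R.

Definition N2 : {set 'I_n.+1} := [set j | (density j < density ord0)%R].

End UnboundedKnapsack.

(* Main.v *)
(** If at least [w_1] items of [N_2] were packed, then by pigeonhole on the
    prefix sums modulo [w_1] some nonempty sub-multiset of them would have
    weight [q * w_1]; exchanging it for [q] copies of type 1 keeps the weight
    and strictly increases the profit.  So fewer than [w_1 <= R] items of [N_2]
    are packed, and their weight is in fact at most [R ^ 2]. *)
Require Import Defs.
From HB Require Import structures.
From mathcomp Require Import all_boot all_order all_algebra.

Set Implicit Arguments.
Unset Strict Implicit.
Unset Printing Implicit Defensive.

Import Order.TTheory GRing.Theory Num.Theory.

(** Two prefix sums congruent modulo [m] differ by the sum over the block between their cut points;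
    that block is [t]. *)
Lemma infix_sum_dvd (T : eqType) (f : T -> nat) (m : nat) (s : seq T) :
    0 < m <= size s ->
  exists t, [/\ infix t s, t != [::] & m %| \sum_(x <- t) f x].
Proof.
case: m => [|m] //= m_le.
pose S k := \sum_(x <- take k s) f x.
(* The modulus is now [m.+1]: the [m.+2] prefix lengths, 0 included, outnumber its residues. [inord]
   never takes its default value, since a remainder is below [m.+1]. *)
pose g (k : 'I_m.+2) : 'I_m.+1 := inord (S k %% m.+1).
have /injectivePn[a [b neq_ab eq_g]] : ~~ injectiveb g.
  by apply/negP => /injectiveP /leq_card; rewrite !card_ord ltnn.
wlog lt_ab : a b neq_ab eq_g / a < b.
  move=> IH; case: (ltngtP a b) => [|lt_ba|/val_inj eq_ab]; first exact: IH.
    by apply: (IH b a) => //; rewrite eq_sym.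
  by rewrite eq_ab eqxx in neq_ab.
have {eq_g} eq_mod : S b = S a %[mod m.+1].
  by move/(congr1 val): eq_g; rewrite /= !inordK ?ltn_mod.
have le_bs : b <= size s by apply: leq_trans m_le; rewrite -ltnS.
have def_b : take b s = take a s ++ take (b - a) (drop a s).
  by rewrite -takeD subnKC // ltnW.
exists (take (b - a) (drop a s)); split.
- apply/infixP; exists (take a s), (drop b s).
  by rewrite catA -def_b cat_take_drop.
- rewrite -size_eq0 size_take size_drop; case: ifP => _.
    by rewrite subn_eq0 -ltnNge.
  by rewrite subn_eq0 -ltnNge (leq_trans lt_ab).
- have := eq_mod; rewrite /S def_b big_cat /= => /eqP.
  by rewrite -[X in _ == X %[mod _]]addn0 eqn_modDl mod0n.
Qed.

Lemma sum_seq_count (I : finType) (f : I -> nat) (s : seq I) :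
  \sum_(i <- s) f i = \sum_i f i * count_mem i s.
Proof.
elim: s => [|i s IH]; first by rewrite big_nil big1 // => i _; rewrite muln0.
rewrite big_cons IH (bigD1 i) //= [RHS](bigD1 i) //= eqxx mulnDr muln1 addnA.
by congr (_ + _); apply: eq_bigr => j /negPf neq_ji; rewrite eq_sym neq_ji.
Qed.

(** Lays a multiset out as a sequence, one entry per copy, so that prefix sums make sense. *)
Lemma multiset_enum (I : finType) (A : {set I}) (y : I -> nat) :
  exists2 s : seq I, size s = \sum_(i in A) y i &
    forall i, count_mem i s = (i \in A) * y i.
Proof.
exists (flatten [seq nseq (y i) i | i <- enum A]).
  rewrite size_flatten /shape -map_comp sumnE big_map big_enum.
  by apply: eq_bigr => i _; rewrite /= size_nseq.
move=> i; rewrite count_flatten -map_comp sumnE big_map big_enum /=.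
have [iA | iNA] := boolP (i \in A).
  rewrite (bigD1 i) //= count_nseq /= eqxx mul1n big1 ?addn0 ?mul1n //.
  by move=> j /andP[_ /negPf neq_ji]; rewrite count_nseq /= neq_ji.
rewrite big1 // => j jA; rewrite count_nseq /=; case: eqP => // eq_ji.
by rewrite -eq_ji jA in iNA.
Qed.

(** The multiplicities in a block are at most those in the whole sequence; the factor [i \in A]
    forces [z] to vanish off [A]. *)
Lemma submultiset_dvd (I : finType) (A : {set I}) (f y : I -> nat) (m : nat) :
    0 < m <= \sum_(i in A) y i ->
  exists z : I -> nat, [/\ forall i, z i <= (i \in A) * y i,
    exists i, 0 < z i & m %| \sum_i f i * z i].
Proof.
have [s <- count_s] := multiset_enum A y.
case/(infix_sum_dvd f) => t [/infixP[s1 [s2 def_s]] t_neq0 dvd_t].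
exists (fun i => count_mem i t); split.
- by move=> i; rewrite -count_s def_s !count_cat addnCA leq_addr.
- by case: t t_neq0 {def_s dvd_t} => // i t _; exists i; rewrite /= eqxx.
- by rewrite -sum_seq_count.
Qed.

(** Clearing the positive denominators keeps the exchange argument inside [nat]. *)
Lemma mem_N2 (n : nat) (p w : 'I_n.+1 -> nat) (j : 'I_n.+1) :
    (forall i, 0 < w i) ->
  (j \in N2 p w) = (p j * w ord0 < p ord0 * w j).
Proof.
move=> w_gt0; rewrite inE /density ltr_pdivrMr ?ltr0n // mulrAC.
by rewrite ltr_pdivlMr ?ltr0n // -!natrM ltr_nat.
Qed.

Lemma optimal_card_N2 (n C : nat) (p w : 'I_n.+1 -> nat) (y : 'I_n.+1 -> nat) :
    (forall i, 0 < w i) -> optimal p w C y ->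
  \sum_(j in N2 p w) y j < w ord0.
Proof.
move=> w_gt0 [feas_y opt_y]; rewrite ltnNge; apply/negP => many.
have /(submultiset_dvd w)[z [le_zy [k zk_gt0] /dvdnP[q def_q]]] :
  0 < w ord0 <= \sum_(j in N2 p w) y j by rewrite w_gt0.
have le_z i : z i <= y i.
  by apply: leq_trans (le_zy i) _; case: (i \in _); rewrite ?mul1n.
have z_N2 i : 0 < z i -> i \in N2 p w.
  by move=> zi_gt0; have := leq_trans zi_gt0 (le_zy i); case: (i \in _).
(* The truncated subtraction is exact by [le_z]. *)
pose y' i := y i - z i + (i == ord0) * q.
(* Stated additively to avoid subtracting sums; used for [f := w] and for [f := p]. *)
have exchange (f : 'I_n.+1 -> nat) :
    \sum_i f i * y' i + \sum_i f i * z i = \sum_i f i * y i + f ord0 * q.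
  have -> : f ord0 * q = \sum_i f i * ((i == ord0) * q).
    rewrite (bigD1 ord0) //= mul1n big1 ?addn0 // => i /negPf->.
    by rewrite muln0.
  rewrite -!big_split; apply: eq_bigr => i _ /=.
  by rewrite -!mulnDr /y' addnAC subnK.
have weight_y' : weight w y' = weight w y.
  apply/eqP; rewrite -(eqn_add2r (\sum_i w i * z i)) /weight exchange def_q.
  by rewrite mulnC.
have le_pq : p ord0 * q <= \sum_i p i * z i.
  have le_y'y : profit p y' <= profit p y by apply: opt_y; rewrite /feasible weight_y'.
  by rewrite -(leq_add2l (profit p y)) /profit -exchange leq_add2r.
(* Termwise the density comparison gives a weak inequality, as [z i] may be 0; the term at [k] is
   strict. Cancelling [w ord0] then contradicts [le_pq]. *)
have : (\sum_i p i * z i) * w ord0 < p ord0 * \sum_i w i * z i.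
  have le_term i : p i * z i * w ord0 <= p ord0 * (w i * z i).
    case: (posnP (z i)) => [->|/z_N2]; first by rewrite !muln0.
    by rewrite mem_N2 // mulnAC mulnA leq_mul2r => /ltnW->; rewrite orbT.
  rewrite big_distrl big_distrr /= (bigD1 k) //= [X in _ < X](bigD1 k) //=.
  rewrite -addSn leq_add //; last by apply: leq_sum => i _.
  by rewrite mulnAC mulnA ltn_pmul2r // -mem_N2 // z_N2.
by rewrite def_q mulnA ltn_pmul2r // ltnNge le_pq.
Qed.

Theorem theorem7 (n R C : nat) (p w : 'I_n.+1 -> nat)
    (hR : 0 < R)
    (hp : forall j, 0 < p j <= R) (hw : forall j, 0 < w j <= R)
    (hsort : sorted_by_density p w)
    (Y : 'I_n.+1 -> nat) (hY : optimal p w C Y) :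
  \sum_(j in N2 p w) Y j * w j <= R ^ 3.
Proof.
have w_gt0 i : 0 < w i by case/andP: (hw i).
have w_leR i : w i <= R by case/andP: (hw i).
apply: (@leq_trans ((\sum_(j in N2 p w) Y j) * R)).
  by rewrite big_distrl /=; apply: leq_sum => j _; rewrite leq_mul2l w_leR orbT.
(* The sharper bound [R ^ 2] is reached first; [0 < R] relaxes it to [R ^ 3]. *)
apply: (@leq_trans (R * R)); last by rewrite mulnn leq_pexp2l.
by rewrite leq_mul2r (leq_trans (ltnW (optimal_card_N2 w_gt0 hY))) ?orbT.
Qed.
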